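(* Let $f$ be twice continuously differentiable and let $z^\ast$ be a differential Stackelberg equilibrium of $f$ with parameters $(L,\mu,\mu_x)$. Choose $\eta_x=\frac{1}{4rL}$ and $\eta_y=\frac{1}{4L}$ with $r\ge 2\kappa$. Suppose that the matrix $M$ is diagonalizable, $M=P^{-1}\Lambda P$ with $\Lambda$ diagonal, and let $C_P=\|P\|_2\|P^{-1}\|_2$. Then there exists $\delta>0$ such that if $\|z^0-z^\ast\|_2\le\delta$, the iterates of GDA and of EG with exact gradient oracle satisfy $$\|z^T-z^\ast\|_2\le C_P\,\|z^0-z^\ast\|_2\left(1-\frac{c_0}{r\kappa_x}\right)^T\quad\text{for all }T\ge0,$$ where $c_0>0$ is a numerical constant. Consequently the number of gradient evaluations needed to reach $\|z^T-z^\ast\|_2\le\epsilon$ is $\mathcal{O}\!\left(r\kappa_x\log\frac{C_P\|z^0-z^\ast\|_2}{\epsilon}\right)$.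
   Context: Let $f:\mathbb{R}^n\times\mathbb{R}^m\to\mathbb{R}$ be twice continuously differentiable, and write $z=(x,y)$. For a point $z^\ast=(x^\ast,y^\ast)$ write the Hessian as $\nabla^2 f(z^\ast)=\begin{pmatrix} C & B\\ B^\top & -A\end{pmatrix}$. The point $z^\ast$ is a differential Stackelberg equilibrium if $\nabla_x f(z^\ast)=0$, $\nabla_y f(z^\ast)=0$, $A\succ 0$ and $C+BA^{-1}B^\top\succ 0$. It has parameters $(L,\mu,\mu_x)$ if $\max\{\|A\|_2,\|B\|_2,\|C\|_2\}\le L$, $\mu=\lambda_{\min}(A)$, $\mu_x=\min\{L,\lambda_{\min}(C+BA^{-1}B^\top)\}$; $\kappa=L/\mu$, $\kappa_x=L/\mu_x$. With stepsizes $\eta_x,\eta_y>0$ and $r=\eta_y/\eta_x$, define $M=\begin{pmatrix}-C & -B\\ rB^\top & -rA\end{pmatrix}$. GDA (exact gradients): $x^{k+1}=x^k-\eta_x\nabla_x f(z^k)$, $y^{k+1}=y^k+\eta_y\nabla_y f(z^k)$, where $z^k=(x^k,y^k)$. EG (exact gradients): $x^{k+1/2}=x^k-\eta_x\nabla_x f(z^k)$, $y^{k+1/2}=y^k+\eta_y\nabla_y f(z^k)$, then $x^{k+1}=x^k-\eta_x\nabla_x f(z^{k+1/2})$, $y^{k+1}=y^k+\eta_y\nabla_y f(z^{k+1/2})$. *)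

(* Defs.v *)
From HB Require Import structures.
From mathcomp Require Import all_boot all_order all_algebra.
From mathcomp Require Import all_classical all_reals all_analysis.
From mathcomp Require Import complex.
Set Implicit Arguments.
Unset Strict Implicit.
Unset Printing Implicit Defensive.
Import Order.TTheory GRing.Theory Num.Theory numFieldNormedType.Exports.
Local Open Scope classical_set_scope.
Local Open Scope ring_scope.

Section Defs.
Variable R : realType.

Definition norm2 {k : nat} (v : 'cV[R]_k) : R :=
  Num.sqrt (\sum_(i < k) v i 0 ^+ 2).

Definition opnorm2 {k l : nat} (A : 'M[R]_(k, l)) : R :=
  sup [set norm2 (A *m v) | v in [set v : 'cV[R]_l | norm2 v = 1]].

Definition cnorm2 {k : nat} (v : 'cV[R[i]]_k) : R :=
  Num.sqrt (\sum_(j < k) (complex.Re (v j 0) ^+ 2 + complex.Im (v j 0) ^+ 2)).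

Definition copnorm2 {k l : nat} (A : 'M[R[i]]_(k, l)) : R :=
  sup [set cnorm2 (A *m v) | v in [set v : 'cV[R[i]]_l | cnorm2 v = 1]].

Definition posdef {k : nat} (A : 'M[R]_k) : Prop :=
  A^T = A /\ forall v : 'cV[R]_k, v != 0 -> 0 < (v^T *m A *m v) 0 0.

Definition lambda_min {k : nat} (A : 'M[R]_k) : R :=
  inf [set a : R | eigenvalue A a].

Variables n m : nat.
Implicit Types (f : 'cV[R]_(n + m) -> R) (z : 'cV[R]_(n + m)).

(* gradient: vector of partial derivatives; x = usubmx z, y = dsubmx z *)
Definition grad f z : 'cV[R]_(n + m) :=
  \col_i derive f z (delta_mx i 0 : 'cV[R]_(n + m)).

Definition hess f z : 'M[R]_(n + m) :=
  \matrix_(i, j) derive (fun w : 'cV[R]_(n + m) => grad f w i 0) z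
                        (delta_mx j 0 : 'cV[R]_(n + m)).

Definition C2 f : Prop :=
  (forall z, differentiable f z) /\
  (forall z, differentiable (grad f) z) /\
  continuous (hess f).

(* Hessian blocks:  hess f z = [[C, B], [B^T, -A]] *)
Definition hC f z : 'M[R]_n := ulsubmx (hess f z).
Definition hB f z : 'M[R]_(n, m) := ursubmx (hess f z).
Definition hA f z : 'M[R]_m := - drsubmx (hess f z).
Definition schur f z : 'M[R]_n :=
  hC f z + hB f z *m invmx (hA f z) *m (hB f z)^T.

Definition DSE f z : Prop :=
  usubmx (grad f z) = 0 /\ dsubmx (grad f z) = 0 /\
  posdef (hA f z) /\ posdef (schur f z).

Definition has_params f z (L mu mux : R) : Prop :=
  Num.max (opnorm2 (hA f z)) (Num.max (opnorm2 (hB f z)) (opnorm2 (hC f z))) <= L /\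
  mu = lambda_min (hA f z) /\
  mux = Num.min L (lambda_min (schur f z)).

Definition Mmat f z (r : R) : 'M[R]_(n + m) :=
  block_mx (- hC f z) (- hB f z) (r *: (hB f z)^T) (- (r *: hA f z)).

Definition gda_update f (etax etay : R) z (w : 'cV[R]_(n + m)) : 'cV[R]_(n + m) :=
  col_mx (usubmx z - etax *: usubmx (grad f w))
         (dsubmx z + etay *: dsubmx (grad f w)).

Definition gda_step f etax etay z := gda_update f etax etay z z.

Definition eg_step f etax etay z :=
  gda_update f etax etay z (gda_update f etax etay z z).

Definition gda f etax etay z0 (T : nat) := iter T (gda_step f etax etay) z0.
Definition eg f etax etay z0 (T : nat) := iter T (eg_step f etax etay) z0.

End Defs.

(* Main.v *)
(** The Jacobians at [z*] of the GDA and EG steps are [1 + eta M] and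
[1 + eta M + eta^2 M^2] with [eta = eta_x], by symmetry of the Hessian.  Let
[lambda = a + i b] be an eigenvalue of [M] with eigenvector [(u, v)].

If [b <> 0], comparing the imaginary parts of the two block rows gives
[|v|^2 = r |u|^2]; the real parts then give [2 a <= L - r mu <= - r mu / 2], while
[b^2 <= r L^2].  If [b = 0] and [a > - mux], eliminating [B^T u = (A + a / r) v] from
the Schur complement inequality forces [u = v = 0]; hence [- r L <= a <= - mux].
In both cases [|1 + eta lambda|] and [|1 + eta lambda + (eta lambda)^2|] are at
most [1 - 1 / (32 r kappa_x)].

So the linearized steps contract in the norm [h |-> |P h|].  Near [z*] half of the
gap absorbs the nonlinear remainder, and going back to the Euclidean norm
costs the factor [C_P] once. *)

Require Import Defs.
From HB Require Import structures.
From mathcomp Require Import all_boot all_order all_algebra.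
From mathcomp Require Import all_classical all_reals all_analysis.
From mathcomp Require Import complex.
From mathcomp Require Import ring lra.
Import Order.TTheory GRing.Theory Num.Theory numFieldNormedType.Exports.
Local Open Scope classical_set_scope.
Local Open Scope ring_scope.

Set Implicit Arguments.
Unset Strict Implicit.

(** * Euclidean norm and symmetric matrices *)

Section Euclidean.
Context {R : realType}.

Definition dotv {k : nat} (x y : 'cV[R]_k) : R := (x^T *m y) 0 0.

Lemma dotvE k (x y : 'cV[R]_k) : dotv x y = \sum_i x i 0 * y i 0.
Proof. by rewrite /dotv mxE; apply: eq_bigr => i _; rewrite mxE. Qed.

Lemma dotvC k (x y : 'cV[R]_k) : dotv x y = dotv y x.
Proof. by rewrite !dotvE; apply: eq_bigr => i _; rewrite mulrC. Qed.

Lemma dotvDr k (x y z : 'cV[R]_k) : dotv x (y + z) = dotv x y + dotv x z.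
Proof. by rewrite /dotv mulmxDr mxE. Qed.

Lemma dotvNr k (x y : 'cV[R]_k) : dotv x (- y) = - dotv x y.
Proof. by rewrite /dotv mulmxN mxE. Qed.

Lemma dotvZr k (x y : 'cV[R]_k) a : dotv x (a *: y) = a * dotv x y.
Proof. by rewrite /dotv -scalemxAr mxE. Qed.

Lemma dotvDl k (x y z : 'cV[R]_k) : dotv (y + z) x = dotv y x + dotv z x.
Proof. by rewrite dotvC dotvDr !(dotvC x). Qed.

Lemma dotvNl k (x y : 'cV[R]_k) : dotv (- y) x = - dotv y x.
Proof. by rewrite dotvC dotvNr (dotvC x). Qed.

Lemma dotvZl k (x y : 'cV[R]_k) a : dotv (a *: y) x = a * dotv y x.
Proof. by rewrite dotvC dotvZr (dotvC x). Qed.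

Definition dotv_lin := (dotvDr, dotvDl, dotvNr, dotvNl, dotvZr, dotvZl).

Lemma dotv_mulmxl k l (A : 'M[R]_(k, l)) x y :
  dotv (A *m x) y = dotv x (A^T *m y).
Proof. by rewrite /dotv trmx_mul mulmxA. Qed.

Lemma dotv_mulmxr k l (A : 'M[R]_(k, l)) x y :
  dotv x (A *m y) = dotv (A^T *m x) y.
Proof. by rewrite dotv_mulmxl trmxK. Qed.

Lemma dotv0l k (x : 'cV[R]_k) : dotv 0 x = 0.
Proof. by rewrite /dotv trmx0 mul0mx mxE. Qed.

Lemma dotv_ge0 k (x : 'cV[R]_k) : 0 <= dotv x x.
Proof. by rewrite dotvE sumr_ge0// => i _; rewrite -expr2 sqr_ge0. Qed.

Lemma dotv_eq0 k (x : 'cV[R]_k) : (dotv x x == 0) = (x == 0).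
Proof.
apply/idP/eqP => [|->]; last by rewrite dotv0l.
rewrite dotvE psumr_eq0 => [/allP x0|i _]; last by rewrite -expr2 sqr_ge0.
apply/colP => i; have /implyP/(_ isT) := x0 i (mem_index_enum i).
by rewrite mulf_eq0 orbb mxE => /eqP.
Qed.

Lemma norm2_sqr k (x : 'cV[R]_k) : norm2 x ^+ 2 = dotv x x.
Proof.
rewrite /norm2 sqr_sqrtr ?sumr_ge0 // => [|i _]; last exact: sqr_ge0.
by rewrite dotvE; apply: eq_bigr => i _; rewrite expr2.
Qed.

Lemma norm2_ge0 k (x : 'cV[R]_k) : 0 <= norm2 x.
Proof. exact: sqrtr_ge0. Qed.

Lemma norm2_eq0 k (x : 'cV[R]_k) : (norm2 x == 0) = (x == 0).
Proof. by rewrite -dotv_eq0 -norm2_sqr sqrf_eq0. Qed.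

Lemma norm20 k : norm2 (0 : 'cV[R]_k) = 0.
Proof. by apply/eqP; rewrite norm2_eq0. Qed.

Lemma norm2Z k a (x : 'cV[R]_k) : norm2 (a *: x) = `|a| * norm2 x.
Proof.
apply/eqP; rewrite -(@eqrXn2 _ 2) ?norm2_ge0 ?mulr_ge0 ?norm2_ge0//.
by rewrite norm2_sqr exprMn norm2_sqr !dotv_lin real_normK ?num_real// expr2 mulrA.
Qed.

Lemma norm2N k (x : 'cV[R]_k) : norm2 (- x) = norm2 x.
Proof. by rewrite -scaleN1r norm2Z normrN1 mul1r. Qed.

(** The form is nonnegative on every [s x + t y]. Taking [(s, t)] to be [(- a, b)] or [(c, - a)]
    gives a positive multiple of [b c - a^2]; if [b = c = 0], taking [(1, - a)] leaves
    [- 2 a^2 >= 0]. *)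
Lemma semidef_CauchySchwarz k (A : 'M[R]_k) (x y : 'cV[R]_k) :
  A^T = A -> (forall v, 0 <= dotv v (A *m v)) ->
  dotv x (A *m y) ^+ 2 <= dotv x (A *m x) * dotv y (A *m y).
Proof.
move=> symA A_ge0; set a := dotv x _; set b := dotv x _; set c := dotv y _.
have yx : dotv y (A *m x) = a by rewrite dotv_mulmxr symA dotvC.
have quad s t : 0 <= s ^+ 2 * b + 2 * (s * t * a) + t ^+ 2 * c.
  have := A_ge0 (s *: x + t *: y).
  rewrite mulmxDr -!scalemxAr !dotv_lin yx -/a -/b -/c; lra.
have b0 : 0 <= b by exact: A_ge0.
have c0 : 0 <= c by exact: A_ge0.
have [b_eq0|b_neq0] := eqVneq b 0; last first.
  have b_gt0 : 0 < b by rewrite lt_neqAle eq_sym b_neq0.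
  rewrite -subr_ge0 -(pmulr_rge0 _ b_gt0); have := quad (- a) b; lra.
have [c_eq0|c_neq0] := eqVneq c 0; last first.
  have c_gt0 : 0 < c by rewrite lt_neqAle eq_sym c_neq0.
  rewrite -subr_ge0 -(pmulr_rge0 _ c_gt0); have := quad c (- a); lra.
have := quad 1 (- a); rewrite b_eq0 c_eq0; lra.
Qed.

Lemma CauchySchwarz_dotv k (x y : 'cV[R]_k) :
  dotv x y ^+ 2 <= dotv x x * dotv y y.
Proof.
have := @semidef_CauchySchwarz k 1%:M x y; rewrite !mul1mx; apply => [|v].
  by rewrite trmx1.
by rewrite mul1mx dotv_ge0.
Qed.

Lemma dotv_le_norm2 k (x y : 'cV[R]_k) : dotv x y <= norm2 x * norm2 y.
Proof.
apply: le_trans (ler_norm _) _.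
rewrite -(@ler_pXn2r _ 2) ?nnegrE ?mulr_ge0 ?norm2_ge0//.
by rewrite real_normK ?num_real// exprMn !norm2_sqr CauchySchwarz_dotv.
Qed.

Lemma ler_norm2D k (x y : 'cV[R]_k) : norm2 (x + y) <= norm2 x + norm2 y.
Proof.
rewrite -(@ler_pXn2r _ 2) ?nnegrE ?addr_ge0 ?norm2_ge0//.
rewrite sqrrD !norm2_sqr !dotv_lin (dotvC y x).
by have := dotv_le_norm2 x y; lra.
Qed.

Lemma norm2_coord k (x : 'cV[R]_k) i : `|x i 0| <= norm2 x.
Proof.
rewrite -(@ler_pXn2r _ 2) ?nnegrE ?norm2_ge0//.
rewrite real_normK ?num_real// norm2_sqr dotvE (bigD1 i)//= -expr2 lerDl.
by rewrite sumr_ge0// => j _; rewrite -expr2 sqr_ge0.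
Qed.

Lemma norm2_le_sum k (x : 'cV[R]_k) : norm2 x <= \sum_i `|x i 0|.
Proof.
have sum0 : 0 <= \sum_i `|x i 0| by rewrite sumr_ge0.
rewrite -(@ler_pXn2r _ 2) ?nnegrE ?norm2_ge0//.
rewrite norm2_sqr dotvE expr2 mulr_suml; apply: ler_sum => i _.
rewrite (le_trans (ler_norm _))// normrM ler_wpM2l// (bigD1 i)//= lerDl.
by rewrite sumr_ge0.
Qed.

(** * Boundedness of matrices and the operator norm *)

Lemma norm2_mulmx_bounded k l (A : 'M[R]_(k, l)) :
  exists2 K, 0 < K & forall v, norm2 (A *m v) <= K * norm2 v.
Proof.
(* The [1 +] keeps the bound positive even for [A = 0], so that it may be divided by. *)
exists (1 + \sum_i \sum_j `|A i j|).
  by rewrite ltr_pwDl// sumr_ge0// => i _; rewrite sumr_ge0.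
move=> v; apply: le_trans (norm2_le_sum _) _.
rewrite mulrDl mul1r ler_wpDl ?norm2_ge0// mulr_suml.
apply: ler_sum => i _; rewrite mxE mulr_suml; apply: le_trans (ler_norm_sum _ _ _) _.
by apply: ler_sum => j _; rewrite normrM ler_wpM2l// norm2_coord.
Qed.

Lemma norm2_normalize k (v : 'cV[R]_k) :
  v != 0 -> norm2 ((norm2 v)^-1 *: v) = 1.
Proof.
rewrite -norm2_eq0 => v0.
by rewrite norm2Z ger0_norm ?invr_ge0 ?norm2_ge0// mulVf.
Qed.

Lemma opnorm2_ubound k l (A : 'M[R]_(k, l)) :
  has_ubound [set norm2 (A *m v) | v in [set v : 'cV[R]_l | norm2 v = 1]].
Proof.
have [K _ AK] := norm2_mulmx_bounded A.
by exists K => _ /= [v v1 <-]; rewrite (le_trans (AK v))// v1 mulr1.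
Qed.

Lemma norm2_mulmx k l (A : 'M[R]_(k, l)) v :
  norm2 (A *m v) <= opnorm2 A * norm2 v.
Proof.
have [->|v0] := eqVneq v 0; first by rewrite mulmx0 !norm20 mulr0.
have nv : 0 < norm2 v by rewrite lt_neqAle norm2_ge0 eq_sym norm2_eq0 v0.
rewrite -ler_pdivrMr// mulrC -[X in X * _]ger0_norm ?invr_ge0 ?norm2_ge0//.
rewrite -norm2Z scalemxAr; apply: ub_le_sup; first exact: opnorm2_ubound.
by exists ((norm2 v)^-1 *: v) => //=; exact: norm2_normalize.
Qed.

Lemma opnorm2_ge0 k l (A : 'M[R]_(k, l)) : 0 <= opnorm2 A.
Proof.
rewrite /opnorm2; set E := [set _ | _ in _].
(* For [l = 0] there is no unit vector, and the supremum of the empty set is 0 by convention. *)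
have [->|/set0P[_ [v v1 _]]] := eqVneq E set0; first by rewrite sup0.
apply: le_trans (norm2_ge0 (A *m v)) _; apply: ub_le_sup; last by exists v.
exact: opnorm2_ubound.
Qed.

(* AM-GM with weight [t], so that the two blocks can be scaled differently. *)
Lemma bilinear_le k l (B : 'M[R]_(k, l)) L t x y :
  0 < L -> 0 < t -> opnorm2 B <= L ->
  2 * t * `|dotv x (B *m y)| <= L * (t ^+ 2 * dotv x x + dotv y y).
Proof.
move=> L0 t0 BL.
have By : dotv (B *m y) (B *m y) <= L ^+ 2 * dotv y y.
  rewrite -!norm2_sqr -exprMn lerXn2r ?nnegrE ?norm2_ge0 ?(mulr_ge0 (ltW L0)) ?norm2_ge0//.
  by apply: le_trans (norm2_mulmx _ _) _; rewrite ler_wpM2r ?norm2_ge0.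
have H1 := dotv_ge0 ((t * L) *: x - B *m y).
have H2 := dotv_ge0 ((t * L) *: x + B *m y).
rewrite !dotv_lin (dotvC (B *m y) x) in H1 H2.
rewrite -(ler_pM2l L0).
by case: (ger0P (dotv x (B *m y))) => _; lra.
Qed.

Lemma quadratic_le k (C : 'M[R]_k) L x : 0 < L -> opnorm2 C <= L ->
  `|dotv x (C *m x)| <= L * dotv x x.
Proof.
move=> L0 CL; have := bilinear_le x x L0 ltr01 CL.
by rewrite expr1n; lra.
Qed.

(* If [A - a] were invertible at the infimum [a] of the Rayleigh quotient, then
   Cauchy-Schwarz for the semidefinite form [A - a] would bound that form
   below by a positive multiple of the squared norm. *)
Lemma rayleigh_min k (A : 'M[R]_k) : (0 < k)%N -> A^T = A ->
  exists2 a, eigenvalue A a & forall v, a * dotv v v <= dotv v (A *m v).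
Proof.
move=> k0 symA; pose E := [set dotv v (A *m v) | v in [set v | dotv v v = 1]].
have [K K0 AK] := norm2_mulmx_bounded A.
have rayleigh v : v != 0 -> E (dotv v (A *m v) / dotv v v).
  move=> v0; exists ((norm2 v)^-1 *: v) => /=.
    by rewrite -norm2_sqr norm2_normalize// expr1n.
  by rewrite -scalemxAr !dotv_lin mulrA mulrC -norm2_sqr -invfM -expr2.
have E_lb : lbound E (- K).
  move=> _ /= [v v1 <-]; rewrite lerNl -dotvNl.
  apply: le_trans (dotv_le_norm2 _ _) _.
  have nv : norm2 v = 1.
    by apply/eqP; rewrite -(@eqrXn2 _ 2) ?norm2_ge0// norm2_sqr v1 expr1n.
  by rewrite norm2N nv mul1r; have := AK v; rewrite nv mulr1.
have E_inf : has_inf E.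
  split; last by exists (- K).
  have v0 : delta_mx (Ordinal k0) 0 != 0 :> 'cV[R]_k.
    apply/eqP => /matrixP/(_ (Ordinal k0) 0); rewrite !mxE !eqxx.
    by apply/eqP; rewrite oner_eq0.
  by eexists; exact: (rayleigh _ v0).
have inf_le v : inf E * dotv v v <= dotv v (A *m v).
  have [->|v0] := eqVneq v 0; first by rewrite !dotv0l mulr0.
  have dv : 0 < dotv v v by rewrite lt_neqAle dotv_ge0 eq_sym dotv_eq0 v0.
  by rewrite -ler_pdivlMr//; apply: ge_inf; [exists (- K)|exact: rayleigh].
exists (inf E) => //; set a := inf E.
pose B := A - a%:M.
have BE v : dotv v (B *m v) = dotv v (A *m v) - a * dotv v v.
  by rewrite mulmxBl mul_scalar_mx !dotv_lin.
have symB : B^T = B by rewrite /B linearB /= symA tr_scalar_mx.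
have B_ge0 v : 0 <= dotv v (B *m v) by rewrite BE subr_ge0 inf_le.
(* If [a] were not an eigenvalue, [B] would be invertible. *)
rewrite /eigenvalue /eigenspace kermx_eq0 row_free_unit -/B.
apply/negP => unitB.
have [K1 K10 BK] := norm2_mulmx_bounded B.
have [K2 K20 VK] := norm2_mulmx_bounded (invmx B).
have low v : dotv v v <= K2 ^+ 2 * K1 * dotv v (B *m v).
  set w := B *m v.
  have vw : dotv v v <= K2 ^+ 2 * dotv w w.
    rewrite -!norm2_sqr -exprMn lerXn2r ?nnegrE ?norm2_ge0 ?(mulr_ge0 (ltW K20)) ?norm2_ge0//.
    by have := VK w; rewrite /w mulKmx.
  have ww : dotv w w <= K1 * dotv v w.
    (* As [w = B v], this reads [|w|^4 <= (w^T B w) (v^T w)]; one factor [|w|^2] then cancels. *)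
    have cs := semidef_CauchySchwarz w v symB B_ge0; rewrite -/w in cs.
    have wBw : dotv w (B *m w) <= K1 * dotv w w.
      rewrite -norm2_sqr expr2 mulrA.
      apply: le_trans (dotv_le_norm2 _ _) _.
      by rewrite mulrC ler_wpM2r ?norm2_ge0.
    have [->|w0] := eqVneq w 0; first by rewrite !(dotvC v) !dotv0l mulr0.
    have dw : 0 < dotv w w by rewrite lt_neqAle dotv_ge0 eq_sym dotv_eq0 w0.
    rewrite -(ler_pM2l dw) -expr2; apply: le_trans cs _.
    by rewrite mulrA (mulrC (dotv w w)) ler_wpM2r// /w B_ge0.
  by apply: le_trans vw _; rewrite -mulrA ler_wpM2l ?sqr_ge0.
set c := K2 ^+ 2 * K1 in low; have c0 : 0 < c by rewrite mulr_gt0 ?exprn_gt0.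
(* A unit vector within [1 / c] of the infimum has [v^T B v < 1 / c], against [low]. *)
have [_ [v /= v1 <-]] := inf_adherent (divr_gt0 ltr01 c0) E_inf.
by have := low v; rewrite BE -/a v1 mulr1 -ler_pdivrMl// mulr1 -div1r; lra.
Qed.

(** Testing the Rayleigh inequality on an eigenvector shows that its constant [a] is below every
    eigenvalue, so the infimum is attained at [a]. Eigenvectors are row vectors here, hence the
    transposes. *)
Lemma lambda_minP k (A : 'M[R]_k) : (0 < k)%N -> A^T = A ->
  eigenvalue A (lambda_min A) /\
  forall v, lambda_min A * dotv v v <= dotv v (A *m v).
Proof.
move=> k0 symA; have [a eig_a a_le] := rayleigh_min k0 symA.
have lb_a : lbound [set b | eigenvalue A b] a.
  move=> b /= /eigenvalueP[v vA v0].
  have dv : 0 < dotv v^T v^T.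
    by rewrite lt_neqAle dotv_ge0 eq_sym dotv_eq0 trmx_eq0 v0.
  have := a_le v^T; rewrite -{1}symA -trmx_mul vA linearZ /= dotvZr.
  by rewrite ler_pM2r.
have -> : lambda_min A = a; last by [].
apply/eqP; rewrite eq_le; apply/andP; split; last by apply: lb_le_inf => //; exists a.
by apply: ge_inf => //; exists a.
Qed.

(** * Positive definite matrices *)

Lemma posdef_quadratic k (A : 'M[R]_k) v :
  posdef A -> v != 0 -> 0 < dotv v (A *m v).
Proof. by move=> [_ A_gt0] v0; rewrite /dotv mulmxA; exact: A_gt0. Qed.

Lemma posdef_unitmx k (A : 'M[R]_k) : posdef A -> A \in unitmx.
Proof.
move=> posA; rewrite -row_free_unit -kermx_eq0; apply/eqP/row_matrixP => i.
apply/eqP; rewrite row0; apply: contraT.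
have : row i (kermx A) *m A = 0 by rewrite -row_mul mulmx_ker row0.
move: (row i _) => w wA; rewrite -trmx_eq0 => w0.
have := posdef_quadratic posA w0.
by rewrite -{1}posA.1 -trmx_mul wA trmx0 dotvC dotv0l ltxx.
Qed.

Lemma posdef_lambda_min k (A : 'M[R]_k) :
  (0 < k)%N -> posdef A -> 0 < lambda_min A.
Proof.
move=> k0 posA; have [/eigenvalueP[v vA v0] _] := lambda_minP k0 posA.1.
have vT0 : v^T != 0 by rewrite trmx_eq0.
have dv : 0 < dotv v^T v^T by rewrite lt_neqAle dotv_ge0 eq_sym dotv_eq0 vT0.
have := posdef_quadratic posA vT0.
by rewrite -{1}posA.1 -trmx_mul vA linearZ /= dotvZr pmulr_lgt0.
Qed.

End Euclidean.

(** * Eigenvalues of the game matrix *)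

Section Spectrum.
Context {R : realType} {n m : nat}.
Implicit Types (A : 'M[R]_m) (B : 'M[R]_(n, m)) (C : 'M[R]_n) (L mu mux r : R)
  (u : 'cV[R]_n) (v : 'cV[R]_m).

(** With [v = A w], the claim follows from [|mu w - A w|^2 >= 0] and [mu |w|^2 <= w^T A w]. *)
Lemma inv_quadratic_le A mu v : A \in unitmx -> 0 < mu ->
  (forall w, mu * dotv w w <= dotv w (A *m w)) ->
  mu * dotv v (invmx A *m v) <= dotv v v.
Proof.
move=> unitA mu_gt0 A_ge.
have [w ->] : exists w, v = A *m w by exists (invmx A *m v); rewrite mulKVmx.
rewrite mulKmx// (dotvC _ w).
have := dotv_ge0 (mu *: w - A *m w); rewrite !dotv_lin (dotvC (A *m w) w).
have := A_ge w; rewrite -(ler_pM2l mu_gt0); lra.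
Qed.

(** Substituting [B^T u = (A + s) v] turns the correction term into [v^T (A + s) A^-1 (A + s) v],
    which no longer involves [B]. *)
Lemma schur_quadratic A B C u v s : A^T = A -> A \in unitmx ->
  B^T *m u = A *m v + s *: v ->
  dotv u ((C + B *m invmx A *m B^T) *m u) =
  dotv u (C *m u) + dotv v (A *m v) + 2 * s * dotv v v
  + s ^+ 2 * dotv v (invmx A *m v).
Proof.
move=> symA unitA eBu.
have AA : dotv (A *m v) (invmx A *m v) = dotv v v.
  by rewrite dotv_mulmxl symA mulKVmx.
rewrite mulmxDl -!mulmxA dotvDr (dotv_mulmxr B) eBu.
rewrite mulmxDr mulKmx// -scalemxAr !dotv_lin AA.
rewrite (dotvC (A *m v) v); ring.
Qed.

(** Scalar core of the real case: [U = |u|^2], [V = |v|^2], [c = u^T C u], [q = v^T A v],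
    [t = v^T A^-1 v], and the eigenvalue is [r s]. Its two main hypotheses are the first block row
    tested against [u] and the Schur complement inequality. *)
Lemma schur_scalar_bound (L mu mux r U V c q t s : R) :
  0 < mu -> 0 < mux -> mux <= L -> 2 <= r -> 2 * L <= r * mu ->
  0 <= U -> 0 <= V -> c + q + s * V + r * s * U = 0 ->
  mux * U <= c + q + 2 * s * V + s ^+ 2 * t ->
  mu * t <= V -> mu * V <= q -> - (L * U) <= c ->
  - mux < r * s -> (U = 0) /\ (V = 0).
Proof.
move=> mu_gt0 mux_gt0 mux_le r_ge2 r_mu U0 V0 e1 e2 tV Vq cU rs.
have L_gt0 : 0 < L by lra.
have r_gt0 : 0 < r by lra.
have mus : 0 < mu + s by rewrite -(pmulr_rgt0 _ r_gt0); lra.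
have V_le : (mu + s) * V <= (L - r * s) * U by lra.
have st : mu * (s ^+ 2 * t) <= s ^+ 2 * V.
  by rewrite mulrCA ler_wpM2l ?sqr_ge0.
(* Subtract [e1] from [e2], multiply by [mu] and replace [mu t] by its bound [V]. *)
have e3 : mu * (mux * U) <= s * ((mu + s) * V) - s * (r * mu * U).
  have : mu * (mux * U) <= mu * (s * V - r * s * U + s ^+ 2 * t).
    by rewrite ler_pM2l//; lra.
  by move: st; lra.
have U_eq0 : U = 0.
  apply/eqP; rewrite eq_le U0 andbT.
  (* For [s <= 0] the [V] term is nonpositive. For [s > 0] it is at most [s L U], while
     [r mu >= 2 L] makes the negative term at least twice as large. *)
  have [s0|s0] := lerP s 0.
    have sV : s * ((mu + s) * V) <= 0 by rewrite mulr_le0_ge0// mulr_ge0// ltW.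
    have k0 : 0 < mu * (mux + r * s) by rewrite mulr_gt0//; lra.
    by rewrite -(pmulr_rle0 _ k0); lra.
  have sU : 0 <= r * s * U by rewrite mulr_ge0// ltW// mulr_gt0.
  have sV : s * ((mu + s) * V) <= s * (L * U) by rewrite ler_pM2l//; lra.
  have sr : s * (2 * L * U) <= s * (r * mu * U) by rewrite ler_pM2l// ler_wpM2r.
  have k0 : 0 < mu * mux + s * L by rewrite addr_gt0// mulr_gt0.
  by rewrite -(pmulr_rle0 _ k0); lra.
split=> //; apply/eqP; rewrite eq_le V0 andbT -(pmulr_rle0 _ mus).
by rewrite (le_trans V_le)// U_eq0 mulr0.
Qed.

Lemma real_eigenvalue_bounds A B C L mu mux r u v a :
  A^T = A -> A \in unitmx -> 0 < mu -> 0 < mux -> mux <= L ->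
  (forall w, mu * dotv w w <= dotv w (A *m w)) ->
  (forall w, mux * dotv w w <= dotv w ((C + B *m invmx A *m B^T) *m w)) ->
  opnorm2 A <= L -> opnorm2 C <= L ->
  2 <= r -> 2 * L <= r * mu ->
  (u != 0) || (v != 0) ->
  - (C *m u) - B *m v = a *: u ->
  r *: (B^T *m u) - r *: (A *m v) = a *: v ->
  - (r * L) <= a <= - mux.
Proof.
move=> symA unitA mu_gt0 mux_gt0 mux_le A_ge S_ge A_le C_le r_ge2 r_mu.
have L_gt0 : 0 < L by lra.
have r_gt0 : 0 < r by lra.
move=> uv0 eu ev; set U := dotv u u; set V := dotv v v.
have r_neq0 : r != 0 by rewrite gt_eqF.
have U0 : 0 <= U by exact: dotv_ge0.
have V0 : 0 <= V by exact: dotv_ge0.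
have UV : 0 < r * U + V.
  rewrite lt_neqAle eq_sym addr_ge0 ?(mulr_ge0 (ltW r_gt0))// andbT.
  rewrite paddr_eq0 ?(mulr_ge0 (ltW r_gt0))// mulf_eq0 (negPf r_neq0) /=.
  by rewrite !dotv_eq0 negb_and.
have cU := quadratic_le u L_gt0 C_le; have qV := quadratic_le v L_gt0 A_le.
rewrite -/U -/V !ler_norml in cU qV; case/andP: cU => cU cU'; case/andP: qV => _ qV.
(* With [s = a / r] the second block row becomes [B^T u = (A + s) v]. *)
pose s := a / r; have as_ : a = r * s by rewrite mulrC divfK.
have eB : B^T *m u = A *m v + s *: v.
  apply: (scalerI r_neq0); rewrite scalerDr scalerA -as_ -ev.
  by rewrite addrC subrK.
have uBv : dotv u (B *m v) = dotv v (A *m v) + s * V.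
  by rewrite dotv_mulmxr eB !dotv_lin dotvC.
have e1 : dotv u (C *m u) + dotv v (A *m v) + s * V + r * s * U = 0.
  have := congr1 (dotv u) eu; rewrite !dotv_lin uBv -/U as_; lra.
apply/andP; split.
  (* The lower bound: [a] is the quotient of [- r (u^T C u + v^T A v)] by [r |u|^2 + |v|^2]. *)
  have UV' : r * s * (r * U + V) = - r * (dotv u (C *m u) + dotv v (A *m v)).
    have -> : dotv u (C *m u) + dotv v (A *m v) = - (s * V + r * s * U) by lra.
    by ring.
  have LU : L * U * 2 <= L * U * r by rewrite ler_wpM2l// mulr_ge0// ltW.
  rewrite -(ler_pM2r UV) as_ UV' mulNr mulNr lerN2 -mulrA ler_pM2l//.
  have LU0 : 0 <= L * U by rewrite mulr_ge0// ltW.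
  lra.
rewrite leNgt as_; apply/negP => rs.
have e2 := S_ge u; rewrite (schur_quadratic C symA unitA eB) in e2.
have [] := schur_scalar_bound mu_gt0 mux_gt0 mux_le r_ge2 r_mu U0 V0
  e1 e2 (inv_quadratic_le v unitA mu_gt0 A_ge) (A_ge v) cU rs.
by move=> eU eV; rewrite eU eV mulr0 addr0 ltxx in UV.
Qed.

(** The eigenvector is [(u + i u', v + i v')] and the eigenvalue [a + i b], written out in real and
    imaginary parts. *)
Lemma complex_eigenvalue_bounds A B C L mu r u u' v v' a b :
  A^T = A -> C^T = C -> 0 < mu -> 0 < L ->
  (forall w, mu * dotv w w <= dotv w (A *m w)) ->
  opnorm2 A <= L -> opnorm2 B <= L -> opnorm2 C <= L ->
  2 <= r -> 2 * L <= r * mu ->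
  b != 0 -> (u != 0) || (u' != 0) || (v != 0) || (v' != 0) ->
  - (C *m u) - B *m v = a *: u - b *: u' ->
  - (C *m u') - B *m v' = b *: u + a *: u' ->
  r *: (B^T *m u) - r *: (A *m v) = a *: v - b *: v' ->
  r *: (B^T *m u') - r *: (A *m v') = b *: v + a *: v' ->
  [/\ 4 * a <= - (r * mu), - (L + r * L) <= 2 * a & b ^+ 2 <= r * L ^+ 2].
Proof.
move=> symA symC mu_gt0 L_gt0 A_ge A_le B_le C_le r_ge2 r_mu.
have r_gt0 : 0 < r by lra.
move=> b0 nz e1 e2 e3 e4.
set U := dotv u u + dotv u' u'; set V := dotv v v + dotv v' v'.
have U0 : 0 <= U by rewrite addr_ge0// dotv_ge0.
have V0 : 0 <= V by rewrite addr_ge0// dotv_ge0.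
(* Up to sign, the imaginary part of the Hermitian product of [u + i u'] with [B (v + i v')]. The
   terms in [C] and [A] drop out of the imaginary parts by symmetry. *)
pose p := dotv u' (B *m v) - dotv u (B *m v').
have vBu x y : dotv x (B^T *m y) = dotv y (B *m x).
  by rewrite dotv_mulmxr trmxK dotvC.
have symdot k (D : 'M[R]_k) x y : D^T = D -> dotv x (D *m y) = dotv y (D *m x).
  by move=> sD; rewrite dotv_mulmxr sD dotvC.
have pU : p = b * U.
  have := congr1 (dotv u') e1; have := congr1 (dotv u) e2.
  rewrite !dotv_lin (symdot _ C u' u symC) (dotvC u' u) /p /U; lra.
have pV : r * p = b * V.
  have := congr1 (dotv v') e3; have := congr1 (dotv v) e4.
  rewrite !dotv_lin !vBu (symdot _ A v' v symA) (dotvC v' v) /p /V; lra.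
have VU : V = r * U by apply: (mulfI b0); rewrite -pV pU mulrCA.
have U_gt0 : 0 < U.
  rewrite lt_neqAle eq_sym U0 andbT; apply/negP => /eqP U_eq0.
  move: nz; have /eqP := VU; rewrite U_eq0 mulr0 /V.
  move/eqP: U_eq0; rewrite /U !paddr_eq0 ?dotv_ge0// !dotv_eq0.
  by move=> /andP[/eqP-> /eqP->] /andP[/eqP-> /eqP->]; rewrite !eqxx.
pose c := dotv u (C *m u) + dotv u' (C *m u').
pose q := dotv v (A *m v) + dotv v' (A *m v').
(* In the real parts the [B] terms of the two rows cancel once the first row is weighted by [r];
   then [V = r U] is used. *)
have aU : - c - q = 2 * a * U.
  have h1 := congr1 (dotv u) e1; have h2 := congr1 (dotv u') e2.
  have h3 := congr1 (dotv v) e3; have h4 := congr1 (dotv v') e4.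
  rewrite !dotv_lin ?vBu (dotvC u' u) in h1 h2 h3 h4.
  have hV : r * (- c - q - a * U) = a * V.
    rewrite (dotvC v' v) in h4; move: h1 h2 h3 h4; rewrite /c /q /U /V; nra.
  have r0 : r != 0 by rewrite gt_eqF.
  by move: hV; rewrite VU mulrCA => /(mulfI r0); lra.
have [cU cU'] : - (L * U) <= c /\ c <= L * U.
  have := quadratic_le u L_gt0 C_le; have := quadratic_le u' L_gt0 C_le.
  by rewrite !ler_norml /c /U => /andP[? ?] /andP[? ?]; split; lra.
have qV : q <= L * V.
  have := quadratic_le v L_gt0 A_le; have := quadratic_le v' L_gt0 A_le.
  by rewrite !ler_norml /q /V => /andP[? ?] /andP[? ?]; lra.
have Vq : mu * V <= q by have := A_ge v; have := A_ge v'; rewrite /q /V; lra.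
rewrite VU in qV Vq; split.
- have rmuU : 2 * L * U <= r * mu * U by rewrite ler_wpM2r.
  by rewrite -(ler_pM2r U_gt0); lra.
- by rewrite -(ler_pM2r U_gt0); lra.
(* The weight [sqrt r] balances the two blocks, since [V = r U]. *)
pose t := Num.sqrt r; have t_gt0 : 0 < t by rewrite sqrtr_gt0.
have tt : t ^+ 2 = r by rewrite sqr_sqrtr// ltW.
have tb : t * `|b| <= L * r.
  have h1 := bilinear_le u' v L_gt0 t_gt0 B_le.
  have h2 := bilinear_le u v' L_gt0 t_gt0 B_le.
  have pn : `|p| <= `|dotv u' (B *m v)| + `|dotv u (B *m v')| by exact: ler_normB.
  have : 2 * t * `|p| <= L * (r * U + V).
    have : 2 * t * `|p| <= 2 * t * (`|dotv u' (B *m v)| + `|dotv u (B *m v')|).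
      by rewrite ler_pM2l// mulr_gt0.
    by rewrite tt in h1 h2; move: h1 h2; rewrite /U /V; lra.
  by rewrite pU normrM (gtr0_norm U_gt0) VU => tp; rewrite -(ler_pM2r U_gt0); lra.
have t2 : (t * `|b|) ^+ 2 <= (L * r) ^+ 2.
  by rewrite lerXn2r ?nnegrE// ?mulr_ge0// ltW.
rewrite !exprMn tt real_normK ?num_real// in t2.
by rewrite -(ler_pM2l r_gt0); lra.
Qed.

End Spectrum.

(** * Moduli of the GDA and EG multipliers *)

Section Rates.
Context {R : realType}.

(* In both lemmas [- p + i b] stands for [eta_x * lambda], [lambda] an eigenvalue of [M],
   and [e] for [1 / (r * kappa_x)]. *)
Lemma gda_factor_le (p b e : R) : e / 8 <= p -> p <= 1 / 4 -> b ^+ 2 <= p / 2 ->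
  0 <= e -> e <= 1 -> (1 - p) ^+ 2 + b ^+ 2 <= (1 - e / 32) ^+ 2.
(* Since [p^2 <= p / 4], the left side is at most [1 - 5 p / 4], and [5 p / 4 >= e / 16]. *)
Proof. by move=> *; nra. Qed.

Lemma eg_factor_le (p b e : R) : e / 8 <= p -> p <= 1 / 4 -> b ^+ 2 <= p / 2 ->
  0 <= e -> e <= 1 ->
  (1 - p + (p ^+ 2 - b ^+ 2)) ^+ 2 + (b - 2 * p * b) ^+ 2 <= (1 - e / 32) ^+ 2.
Proof.
move=> pe p4 bp e0 e1.
have b0 : 0 <= b ^+ 2 by exact: sqr_ge0.
have pp : p ^+ 2 <= p / 4 by nra.
have p0 : 0 <= p by lra.
set X := 1 - p + _.
have X0 : 0 <= X by rewrite /X; have := sqr_ge0 p; lra.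
have X1 : X <= 1 by rewrite /X; lra.
(* Replacing [X^2] by [X] lets its [- b^2] cancel the [b^2] from the imaginary part, leaving
   [1 - p + p^2]. *)
have XX : X ^+ 2 <= X by rewrite expr2 ler_piMr.
have -> : (b - 2 * p * b) ^+ 2 = b ^+ 2 * (1 - 2 * p) ^+ 2 by ring.
have : b ^+ 2 * (1 - 2 * p) ^+ 2 <= b ^+ 2 by rewrite ler_piMr//; nra.
by move: XX; rewrite /X; nra.
Qed.

End Rates.

(** * Hermitian norm and diagonalization *)

Section ComplexNorm.
Context {R : realType}.

(** Identifies [C^k] with [R^(2k)], so that the complex norms inherit the properties of the real
    ones. *)
Definition realify {k : nat} (v : 'cV[R[i]]_k) : 'cV[R]_(k + k) :=
  col_mx (map_mx (@complex.Re R) v) (map_mx (@complex.Im R) v).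

Definition realify_mx {k l : nat} (A : 'M[R[i]]_(k, l)) : 'M[R]_(k + k, l + l) :=
  let X := map_mx (@complex.Re R) A in let Y := map_mx (@complex.Im R) A in
  block_mx X (- Y) Y X.

Lemma ReM (x y : R[i]) :
  complex.Re (x * y) = complex.Re x * complex.Re y - complex.Im x * complex.Im y.
Proof. by case: x y => [a b] [c d]. Qed.

Lemma ImM (x y : R[i]) :
  complex.Im (x * y) = complex.Re x * complex.Im y + complex.Im x * complex.Re y.
Proof. by case: x y => [a b] [c d] /=; rewrite addrC. Qed.

Lemma cnorm2E k (v : 'cV[R[i]]_k) : cnorm2 v = norm2 (realify v).
Proof.
rewrite /cnorm2 /norm2 big_split_ord /= big_split /=.
by congr (Num.sqrt (_ + _)); apply: eq_bigr => i _;
  rewrite ?col_mxEu ?col_mxEd mxE.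
Qed.

Lemma realifyD k (v w : 'cV[R[i]]_k) : realify (v + w) = realify v + realify w.
Proof. by rewrite /realify !map_mxD add_col_mx. Qed.

Lemma realify_mul k l (A : 'M[R[i]]_(k, l)) v :
  realify (A *m v) = realify_mx A *m realify v.
Proof.
rewrite /realify /realify_mx mul_block_col mulNmx; congr col_mx;
  apply/matrixP => i j; rewrite !mxE raddf_sum /=.
  by rewrite -sumrB; apply: eq_bigr => h _; rewrite !mxE ReM.
rewrite addrC -big_split; apply: eq_bigr => h _; rewrite !mxE ImM //.
Qed.

Lemma realify_surj k (w : 'cV[R]_(k + k)) : exists v, w = realify v.
Proof.
exists (\col_i (usubmx w i 0 +i* dsubmx w i 0)%C).
rewrite -{1}(vsubmxK w); congr col_mx;
by apply/matrixP => i j; rewrite !mxE /= !ord1.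
Qed.

Lemma copnorm2E k l (A : 'M[R[i]]_(k, l)) : copnorm2 A = opnorm2 (realify_mx A).
Proof.
congr sup; apply/seteqP; split=> _ /= [v v1 <-].
  by exists (realify v); rewrite -?cnorm2E// -realify_mul cnorm2E.
have [w vw] := realify_surj v; exists w; first by rewrite cnorm2E -vw.
by rewrite cnorm2E realify_mul -vw.
Qed.

Lemma cnorm2_ge0 k (v : 'cV[R[i]]_k) : 0 <= cnorm2 v.
Proof. exact: sqrtr_ge0. Qed.

Lemma copnorm2_ge0 k l (A : 'M[R[i]]_(k, l)) : 0 <= copnorm2 A.
Proof. by rewrite copnorm2E opnorm2_ge0. Qed.

Lemma ler_cnorm2D k (v w : 'cV[R[i]]_k) : cnorm2 (v + w) <= cnorm2 v + cnorm2 w.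
Proof. by rewrite !cnorm2E realifyD ler_norm2D. Qed.

Lemma cnorm2_mulmx k l (A : 'M[R[i]]_(k, l)) v :
  cnorm2 (A *m v) <= copnorm2 A * cnorm2 v.
Proof. by rewrite !cnorm2E copnorm2E realify_mul norm2_mulmx. Qed.

Lemma cnorm2_real k (v : 'cV[R]_k) : cnorm2 (map_mx (real_complex R) v) = norm2 v.
Proof.
rewrite /cnorm2 /norm2; congr Num.sqrt; apply: eq_bigr => i _.
by rewrite !mxE /= expr0n addr0.
Qed.

Lemma cnorm2_le_coord k (v w : 'cV[R[i]]_k) (rho : R) : 0 <= rho ->
  (forall i, complex.Re (v i 0) ^+ 2 + complex.Im (v i 0) ^+ 2 <=
    rho ^+ 2 * (complex.Re (w i 0) ^+ 2 + complex.Im (w i 0) ^+ 2)) ->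
  cnorm2 v <= rho * cnorm2 w.
Proof.
move=> rho0 vw; rewrite /cnorm2 -[rho in X in _ <= X]ger0_norm// -sqrtr_sqr.
rewrite -sqrtrM ?sqr_ge0// ler_sqrt ?mulr_ge0 ?sqr_ge0//.
  by rewrite mulr_sumr; apply: ler_sum => i _; exact: vw.
by rewrite sumr_ge0// => i _; rewrite addr_ge0 ?sqr_ge0.
Qed.

Lemma complex_normM_sqr (x y : R[i]) :
  complex.Re (x * y) ^+ 2 + complex.Im (x * y) ^+ 2 =
  (complex.Re x ^+ 2 + complex.Im x ^+ 2) * (complex.Re y ^+ 2 + complex.Im y ^+ 2).
Proof. by rewrite ReM ImM; ring. Qed.

End ComplexNorm.

(** * Eigenvectors and the action of the steps in the eigenbasis *)

Section Diagonalization.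
Context {R : realType}.
Let cplx {k l} := @map_mx _ _ (real_complex R) k l.

(** The [j]-th column of [P^-1] is a complex eigenvector; as [M] is real, its real and imaginary
    parts satisfy the two stated equations. *)
Lemma real_complex_eigenvector k (M : 'M[R]_k) (P Lam : 'M[R[i]]_k) j :
  P \in unitmx -> is_diag_mx Lam -> cplx M = invmx P *m Lam *m P ->
  let a := complex.Re (Lam j j) in let b := complex.Im (Lam j j) in
  exists x y : 'cV[R]_k, [/\ (x != 0) || (y != 0),
    M *m x = a *: x - b *: y & M *m y = b *: x + a *: y].
Proof.
move=> unitP /is_diag_mxP diagL MP a b.
pose w : 'cV[R[i]]_k := invmx P *m delta_mx j 0.
have w0 : w != 0.
  apply/eqP => /(congr1 (mulmx P)); rewrite mulmx0 /w mulKVmx// => /matrixP/(_ j 0).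
  by rewrite !mxE !eqxx => /eqP; rewrite oner_eq0.
have Mw : cplx M *m w = Lam j j *: w.
  rewrite MP -!mulmxA mulKVmx// scalemxAr; congr (_ *m _).
  apply/matrixP => i h; rewrite !mxE (bigD1 j)//= big1 => [|i' ij]; last first.
    by rewrite mxE (negPf ij) mulr0.
  rewrite !mxE !ord1 !eqxx addr0 mulr1 andbT; case: eqVneq => [->|ij].
    by rewrite mulr1.
  by rewrite mulr0 diagL.
clearbody w.
pose x := map_mx (@complex.Re R) w; pose y := map_mx (@complex.Im R) w.
exists x, y; split.
- apply: contraR w0; rewrite negb_or !negbK => /andP[/eqP x0 /eqP y0].
  apply/eqP/matrixP => i h.
  have /matrixP/(_ i h) := x0; have /matrixP/(_ i h) := y0; rewrite !mxE.
  by case: (w i h) => c d /= -> ->.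
- apply/matrixP => i h; have /matrixP/(_ i h)/(congr1 (@complex.Re R)) := Mw.
  rewrite !mxE raddf_sum /= ReM => <-; apply: eq_bigr => l _.
  by rewrite !mxE ReM /= mul0r subr0.
- apply/matrixP => i h; have /matrixP/(_ i h)/(congr1 (@complex.Im R)) := Mw.
  rewrite !mxE raddf_sum /= ImM addrC => <-; apply: eq_bigr => l _.
  by rewrite !mxE ImM /= mul0r addr0.
Qed.

(* [1 + eta M] and [1 + eta M + eta^2 M^2] are the Jacobians of the GDA and EG
   steps; in the norm [h |-> |P h|] they act diagonally. *)
Lemma diag_step_le k (M : 'M[R]_k) (P Lam : 'M[R[i]]_k) (eta rho : R) :
  P \in unitmx -> is_diag_mx Lam -> cplx M = invmx P *m Lam *m P -> 0 <= rho ->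
  (forall j, let p := - (eta * complex.Re (Lam j j)) in
     let b := eta * complex.Im (Lam j j) in
     (1 - p) ^+ 2 + b ^+ 2 <= rho ^+ 2 /\
     (1 - p + (p ^+ 2 - b ^+ 2)) ^+ 2 + (b - 2 * p * b) ^+ 2 <= rho ^+ 2) ->
  forall h,
    cnorm2 (P *m cplx (h + eta *: (M *m h))) <= rho * cnorm2 (P *m cplx h) /\
    cnorm2 (P *m cplx (h + eta *: (M *m (h + eta *: (M *m h)))))
      <= rho * cnorm2 (P *m cplx h).
Proof.
move=> unitP /is_diag_mxP diagL MP rho0 Hrho h.
have diagM (w : 'cV[R[i]]_k) i : (Lam *m w) i 0 = Lam i i * w i 0.
  rewrite mxE (bigD1 i)//= big1 ?addr0// => j ji.
  by rewrite diagL ?mul0r// eq_sym.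
(* In the coordinates [P h], multiplication by [M] becomes multiplication by [Lam]. *)
have PM h' w : P *m cplx (h' + eta *: (M *m w)) =
    P *m cplx h' + (eta%:C)%C *: (Lam *m (P *m cplx w)).
  rewrite /cplx map_mxD mulmxDr; congr (_ + _).
  rewrite map_mxZ map_mxM /= -/cplx -scalemxAr.
  by rewrite -!/(cplx _) MP -!mulmxA mulKVmx.
have coordM (x y : 'cV[R[i]]_k) c i :
    (x + c *: (Lam *m y)) i 0 = x i 0 + c * (Lam i i * y i 0).
  by rewrite mxE [in X in _ + X]mxE diagM.
split.
  rewrite PM; set w := P *m _.
  apply: cnorm2_le_coord => // i.
  have -> : (w + (eta%:C)%C *: (Lam *m w)) i 0 = (1 + (eta%:C)%C * Lam i i) * w i 0.
    by rewrite coordM mulrDl mul1r mulrA.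
  rewrite complex_normM_sqr ler_wpM2r ?addr_ge0 ?sqr_ge0//.
  have [H _] := Hrho i; apply: le_trans H; rewrite le_eqVlt; apply/orP; left.
  by apply/eqP; case: (Lam i i) => c d /=; ring.
rewrite !PM; set w := P *m _; apply: cnorm2_le_coord => // i.
have -> : (w + (eta%:C)%C *: (Lam *m (w + (eta%:C)%C *: (Lam *m w)))) i 0
    = (1 + (eta%:C)%C * Lam i i * (1 + (eta%:C)%C * Lam i i)) * w i 0.
  by rewrite !coordM; ring.
rewrite complex_normM_sqr ler_wpM2r ?addr_ge0 ?sqr_ge0//.
have [_ H] := Hrho i; apply: le_trans H; rewrite le_eqVlt; apply/orP; left.
by apply/eqP; case: (Lam i i) => c d /=; ring.
Qed.

End Diagonalization.

(** * Second derivatives *)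

Section SecondOrder.
Context {R : realType}.

(** Differentiability is stated with the max norm; this comparison and the next transfer it to
    [norm2]. *)
Lemma normr_le_norm2 k (x : 'cV[R]_k) : `|x| <= norm2 x.
Proof.
rewrite /Num.norm /= mx_normrE; apply: bigmax_le; first exact: norm2_ge0.
by case=> i j _ /=; rewrite (ord1 j) norm2_coord.
Qed.

Lemma norm2_le_normr k (x : 'cV[R]_k) : norm2 x <= k%:R * `|x|.
Proof.
apply: le_trans (norm2_le_sum x) _.
rewrite -[k in k%:R]card_ord mulr_natl -sumr_const; apply: ler_sum => i _.
by rewrite [leRHS]/Num.norm /= mx_normrE (le_bigmax _ (fun ij => `|x ij.1 ij.2|) (i, 0)).
Qed.

Lemma differentiable_norm2 k l (g : 'cV[R]_k -> 'cV[R]_l) z :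
  differentiable g z -> forall eps : R, 0 < eps -> exists2 delta : R, 0 < delta &
  forall h, norm2 h <= delta -> norm2 (g (z + h) - g z - 'd g z h) <= eps * norm2 h.
Proof.
(* The tolerance [eps / (l + 1)] pays for the factor [l] between the norms; the [+ 1] covers
   [l = 0]. *)
move=> dg eps eps0; have l0 : 0 < l%:R + 1 :> R by rewrite ltr_wpDl.
have /eqaddoP/(_ _ (divr_gt0 eps0 l0)) := diff_locally dg.
move=> /nbhs_ballP[d /= d0 dP]; exists (d / 2); first by rewrite divr_gt0.
move=> h hd; have /dP gh : ball (0 : 'cV[R]_k) d h.
  rewrite -ball_normE /= sub0r normrN (le_lt_trans (normr_le_norm2 h))//.
  by apply: le_lt_trans hd _; lra.
have -> : g (z + h) - g z - 'd g z h = (g \o shift z - (cst (g z) + 'd g z)) h.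
  by rewrite -addrA -opprD [z + h]addrC.
apply: le_trans (norm2_le_normr _) _.
apply: (@le_trans _ _ ((l%:R + 1) * (eps / (l%:R + 1) * `|h|))).
  by apply: ler_pM => //; rewrite lerDl.
rewrite mulrA mulrCA divff ?gt_eqF// mulr1 ler_pM2l//; exact: normr_le_norm2.
Qed.

(** Both derivatives are limits of the same difference quotient. *)
Lemma is_derive_line k (f : 'cV[R]_k -> R) (x v : 'cV[R]_k) s :
  differentiable f (x + s *: v) ->
  is_derive s 1 (fun t => f (x + t *: v)) ('D_v f (x + s *: v)).
Proof.
move=> df; have dv : derivable f (x + s *: v) v by exact: diff_derivable.
have E : (fun h => h^-1 *: (((fun t => f (x + t *: v)) \o shift s) (h *: (1 : R))
                            - f (x + s *: v))) =
   (fun h => h^-1 *: ((f \o shift (x + s *: v)) (h *: v) - f (x + s *: v))).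
  apply/funext => h /=; congr (_ *: (f _ - _)).
  by rewrite [h *: 1]mulr1 scalerDl addrCA.
by split; [rewrite /derivable E|rewrite /derive E].
Qed.

Context {n m : nat}.
Implicit Types (f : 'cV[R]_(n + m) -> R) (z h : 'cV[R]_(n + m)).

(** Expand [h] in the standard basis: on the [j]-th basis vector the differential is a directional
    derivative, which is column [j] of the Hessian. *)
Lemma diff_grad f z h : differentiable (grad f) z -> 'd (grad f) z h = hess f z *m h.
Proof.
move=> dg; rewrite [in LHS](matrix_sum_delta h).
rewrite linear_sum /= [RHS](_ : _ = \sum_j h j 0 *: col j (hess f z)); last first.
  apply/matrixP => i j; rewrite mxE summxE; apply: eq_bigr => l _.
  by rewrite !mxE (ord1 j) mulrC.
apply: eq_bigr => j _; rewrite big_ord1 linearZ /=; congr (_ *: _).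
rewrite -deriveE// derive_mx; last exact: diff_derivable.
by apply/matrixP => i l; rewrite !mxE !ord1.
Qed.

(** The mean value theorem for [phi] on [[0, t]] writes the second difference as [t] times a
    difference of two values of the gradient, and the expansion of the gradient at [z] evaluates the
    latter as [t H_ij] up to a small multiple of [t]. *)
Lemma second_difference f z i j :
  (forall w, differentiable f w) -> differentiable (grad f) z ->
  forall eps : R, 0 < eps -> exists2 delta : R, 0 < delta & forall t : R, 0 < t -> t <= delta ->
  `|f (z + t *: delta_mx i 0 + t *: delta_mx j 0) - f (z + t *: delta_mx i 0)
    - f (z + t *: delta_mx j 0) + f z - t ^+ 2 * hess f z i j| <= eps * t ^+ 2.
Proof.
move=> df dg eps eps0.
(* The two gradient remainders occur at distances at most [t] and [2 t], so thirds add up to [eps];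
   the radius [d / 2] below accounts for the [2 t]. *)
have eps3 : 0 < eps / 3 by rewrite divr_gt0.
have [d d0 dP] := differentiable_norm2 dg eps3.
exists (d / 2) => [|t t0 td]; first by rewrite divr_gt0.
set ei : 'cV[R]_(n + m) := delta_mx i 0; set ej : 'cV[R]_(n + m) := delta_mx j 0.
pose D h := grad f (z + h) - grad f z - 'd (grad f) z h.
pose phi (s : R) : R := f (z + t *: ej + s *: ei) - f (z + s *: ei).
pose dphi (s : R) : R := grad f (z + t *: ej + s *: ei) i 0 - grad f (z + s *: ei) i 0.
have dphiP (s : R) : is_derive s (1 : R) phi (dphi s).
  have := is_deriveB (is_derive_line (df (z + t *: ej + s *: ei)))
                     (is_derive_line (df (z + s *: ei))).
  by rewrite /dphi !mxE.
have cphi : {within `[0, t], continuous phi}.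
  by apply: derivable_within_continuous => s _; case: (dphiP s).
have [c c0t] := MVT_segment (ltW t0) (fun s _ => dphiP s) cphi.
move: c0t; rewrite in_itv /= => /andP[c0 ct] phit.
have normei s l : norm2 (s *: delta_mx l 0 : 'cV[R]_(n + m)) = `|s|.
  rewrite norm2Z [X in _ * X](_ : _ = 1) ?mulr1//.
  apply/eqP; rewrite -(@eqrXn2 _ 2) ?norm2_ge0// norm2_sqr dotvE expr1n.
  rewrite (bigD1 l)//= big1 => [|l' ll']; rewrite !mxE ?eqxx ?mulr1 ?addr0//.
  by rewrite (negPf ll') mul0r.
have nc : norm2 (c *: ei) <= t by rewrite normei ger0_norm.
have ntc : norm2 (t *: ej + c *: ei) <= 2 * t.
  apply: le_trans (ler_norm2D _ _) _; rewrite !normei !ger0_norm ?(ltW t0)//; lra.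
have D1 : `|D (c *: ei) i 0| <= eps / 3 * t.
  apply: le_trans (norm2_coord _ _) _; apply: le_trans (dP _ _) _; first lra.
  by rewrite ler_pM2l.
have D2 : `|D (t *: ej + c *: ei) i 0| <= eps / 3 * (2 * t).
  apply: le_trans (norm2_coord _ _) _; apply: le_trans (dP _ _) _; first lra.
  by rewrite ler_pM2l.
have dphiE : dphi c = t * hess f z i j + (D (t *: ej + c *: ei) i 0 - D (c *: ei) i 0).
  have hj : (hess f z *m (t *: ej)) i 0 = t * hess f z i j.
    by rewrite -scalemxAr -colE !mxE.
  rewrite -hj -diff_grad// /D linearD /dphi -addrA /=.
  move: (grad f (z + _)) (grad f (z + _)) (grad f z) ('d _ _ _) ('d _ _ _) => g1 g2 g3 g4 g5.
  rewrite !mxE; ring.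
have -> : f (z + t *: ei + t *: ej) - f (z + t *: ei) - f (z + t *: ej) + f z =
    dphi c * t.
  rewrite subr0 in phit; rewrite -phit /phi !scale0r !addr0 (addrAC z); ring.
rewrite dphiE (_ : _ - _ = t * (D (t *: ej + c *: ei) i 0 - D (c *: ei) i 0)); last ring.
rewrite normrM gtr0_norm// expr2 mulrCA ler_pM2l//.
by apply: le_trans (ler_normB _ _) _; lra.
Qed.

(** The second difference is symmetric in [i] and [j], so it approximates both entries, each up to
    [e / 2]. *)
Lemma hess_sym f z : (forall w, differentiable f w) ->
  differentiable (grad f) z -> (hess f z)^T = hess f z.
Proof.
move=> df dg; apply/matrixP => i j; rewrite mxE.
apply/eqP; rewrite eq_sym -subr_eq0 -normr_le0; apply/ler_addgt0Pl => e e0.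
rewrite addr0; have e2 : 0 < e / 2 by rewrite divr_gt0.
have [d1 d10 d1P] := second_difference i j df dg e2.
have [d2 d20 d2P] := second_difference j i df dg e2.
pose t := Num.min d1 d2; have t0 : 0 < t by rewrite lt_min d10.
have := d1P t t0; rewrite ge_min lexx => /(_ isT).
have := d2P t t0; rewrite ge_min lexx orbT => /(_ isT).
rewrite (addrAC z) [_ - f (z + t *: delta_mx j 0) - _]addrAC.
set X := _ + f z => h2 h1.
have t2 : 0 < t ^+ 2 by rewrite exprn_gt0.
rewrite -(ler_pM2r t2) -[X in _ * X](gtr0_norm t2) -normrM.
have -> : (hess f z i j - hess f z j i) * t ^+ 2 =
  (X - t ^+ 2 * hess f z j i) - (X - t ^+ 2 * hess f z i j) by ring.
by apply: le_trans (ler_normB _ _) _; lra.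
Qed.

End SecondOrder.

(** * Local linear convergence *)

Section Linearization.
Context {R : realType}.

(** Fréchet differentiability in the Euclidean norm with an explicit Jacobian, so that the Jacobians
    of the steps come out as matrix expressions. *)
Definition linearizes {k l} (G : 'cV[R]_k -> 'cV[R]_l) z0 (J : 'M[R]_(l, k)) :=
  forall eps : R, 0 < eps -> exists2 delta : R, 0 < delta &
  forall h, norm2 h <= delta -> norm2 (G (z0 + h) - G z0 - J *m h) <= eps * norm2 h.

Lemma linearizes_mulmx k l p (E : 'M[R]_(p, l)) (G : 'cV[R]_k -> 'cV[R]_l) z0 J :
  linearizes G z0 J -> linearizes (fun z => E *m G z) z0 (E *m J).
Proof.
move=> GJ eps eps0; have [K K0 EK] := norm2_mulmx_bounded E.
have [d d0 dP] := GJ _ (divr_gt0 eps0 K0).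
exists d => // h hd; rewrite -mulmxA -!mulmxBr (le_trans (EK _))//.
by rewrite -ler_pdivlMl// mulrA [_^-1 * _]mulrC dP.
Qed.

Lemma linearizes_comp k l p (F : 'cV[R]_l -> 'cV[R]_p) (G : 'cV[R]_k -> 'cV[R]_l)
    z0 J J' :
  linearizes G z0 J -> linearizes F (G z0) J' ->
  linearizes (F \o G) z0 (J' *m J).
Proof.
move=> GJ FJ eps eps0; have [K K0 JK] := norm2_mulmx_bounded J.
have [K' K'0 J'K] := norm2_mulmx_bounded J'.
have K1 : 0 < K + 1 by lra.
have e2 : 0 < eps / 2 by rewrite divr_gt0.
(* The bound 1 keeps the increment of [G] below [(K + 1) |h|]; the other one makes the image of its
   remainder under [J'] at most half of the allowed error. *)
pose e1 := Num.min 1 (eps / 2 / K').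
have e10 : 0 < e1 by rewrite lt_min ltr01 divr_gt0.
have [d d0 dP] := GJ _ e10; have [d' d'0 d'P] := FJ _ (divr_gt0 e2 K1).
exists (Num.min d (d' / (K + 1))); first by rewrite lt_min d0 divr_gt0.
move=> h; rewrite le_min ler_pdivlMr// => /andP[hd hd'] /=.
have := dP h hd; set rem := G (z0 + h) - G z0 - J *m h => rem_le.
pose h' := G (z0 + h) - G z0.
have h'E : h' = J *m h + rem by rewrite /rem [RHS]addrC subrK.
have h'_le : norm2 h' <= (K + 1) * norm2 h.
  rewrite h'E mulrDl (le_trans (ler_norm2D _ _))// lerD ?JK//.
  by rewrite (le_trans rem_le)// ler_wpM2r ?norm2_ge0// ge_min lexx.
have -> : G (z0 + h) = G z0 + h' by rewrite /h' [RHS]addrC subrK.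
clearbody h'.
have -> : F (G z0 + h') - F (G z0) - J' *m J *m h =
    (F (G z0 + h') - F (G z0) - J' *m h') + J' *m rem.
  have -> : J' *m h' = J' *m J *m h + J' *m rem by rewrite h'E mulmxDr mulmxA.
  by rewrite opprD addrA subrK.
apply: le_trans (ler_norm2D _ _) _.
have /d'P h1 : norm2 h' <= d' by rewrite (le_trans h'_le)// mulrC.
have h2 : eps / 2 / (K + 1) * norm2 h' <= eps / 2 * norm2 h.
  by rewrite -mulrA ler_pM2l// ler_pdivrMl.
have h3 : norm2 (J' *m rem) <= eps / 2 * norm2 h.
  rewrite (le_trans (J'K _))// -ler_pdivlMl// (le_trans rem_le)//.
  by rewrite mulrA [_^-1 * _]mulrC ler_wpM2r ?norm2_ge0// ge_min lexx orbT.
by apply: le_trans (lerD (le_trans h1 h2) h3) _; lra.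
Qed.

Lemma linearizesD k l (F G : 'cV[R]_k -> 'cV[R]_l) z0 J J' :
  linearizes F z0 J -> linearizes G z0 J' ->
  linearizes (fun z => F z + G z) z0 (J + J').
Proof.
move=> FJ GJ eps eps0; have e2 : 0 < eps / 2 by rewrite divr_gt0.
have [d d0 dP] := FJ _ e2; have [d' d'0 d'P] := GJ _ e2.
exists (Num.min d d'); first by rewrite lt_min d0.
move=> h; rewrite le_min => /andP[/dP h1 /d'P h2].
have regroup (a b c d1 d2 e : 'cV[R]_l) :
    a + b - (c + d1) - (d2 + e) = (a - c - d2) + (b - d1 - e).
  by rewrite !opprD (addrACA a) (addrACA (a - c)).
rewrite mulmxDl regroup (le_trans (ler_norm2D _ _))//.
by apply: le_trans (lerD h1 h2) _; lra.
Qed.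

Lemma linearizes_id k (z0 : 'cV[R]_k) : linearizes id z0 1%:M.
Proof.
move=> eps eps0; exists 1 => // h _.
by rewrite mul1mx addrC addrA [- h + _]addrC addrK subrr norm20 mulr_ge0 ?norm2_ge0 ?ltW.
Qed.

(* The error contracts in the norm [h |-> |P h|]; the gap [rho < rho'] absorbs
   the nonlinear remainder, so that only the change of norm costs a constant. *)
Lemma local_linear_rate k (G : 'cV[R]_k -> 'cV[R]_k) zs J (P : 'M[R[i]]_k) (rho rho' : R) :
  G zs = zs -> linearizes G zs J -> P \in unitmx ->
  (forall h, cnorm2 (P *m map_mx (real_complex R) (J *m h)) <=
    rho * cnorm2 (P *m map_mx (real_complex R) h)) ->
  0 <= rho -> rho < rho' -> rho' <= 1 ->
  let CP := copnorm2 P * copnorm2 (invmx P) in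
  exists2 delta : R, 0 < delta & forall z0, norm2 (z0 - zs) <= delta ->
    forall T, norm2 (iter T G z0 - zs) <= CP * norm2 (z0 - zs) * rho' ^+ T.
Proof.
move=> Gzs GJ unitP Jrho rho0 rr' r'1 CP.
pose N h := cnorm2 (P *m map_mx (real_complex R) h).
have CP0 : 0 <= CP by rewrite mulr_ge0 ?copnorm2_ge0.
have CP1 : 0 < CP + 1 by lra.
have N_le h : N h <= copnorm2 P * norm2 h by rewrite -(cnorm2_real h) cnorm2_mulmx.
have le_N h : norm2 h <= copnorm2 (invmx P) * N h.
  rewrite -(cnorm2_real h) (le_trans _ (cnorm2_mulmx _ _))//.
  by rewrite mulKmx.
have ND h h' : N (h + h') <= N h + N h' by rewrite /N map_mxD mulmxDr ler_cnorm2D.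
(* The remainder is measured in the Euclidean norm; passing to [N] and back costs at most [CP], and
   the [+ 1] keeps the denominator positive. *)
have gap : 0 < (rho' - rho) / (CP + 1) by rewrite divr_gt0// subr_gt0.
have [d d0 dP] := GJ _ gap.
have step h : norm2 h <= d -> N (G (zs + h) - zs) <= rho' * N h.
  move=> /dP; rewrite Gzs => rem_le.
  rewrite -[G _ - zs](subrK (J *m h)) (le_trans (ND _ _))//.
  have : N (G (zs + h) - zs - J *m h) <= (rho' - rho) * N h.
    apply: le_trans (N_le _) _.
    apply: le_trans (ler_wpM2l (copnorm2_ge0 P) rem_le) _.
    have : copnorm2 P * norm2 h <= (CP + 1) * N h.
      rewrite mulrDl mul1r ler_wpDr ?cnorm2_ge0// /CP -mulrA.
      by rewrite ler_wpM2l ?copnorm2_ge0.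
    move=> PN; rewrite mulrCA; apply: le_trans (ler_wpM2l (ltW gap) PN) _.
    by rewrite mulrA divfK// gt_eqF.
  by have := Jrho h; rewrite -/(N h) -/(N (J *m h)); lra.
have r'0 : 0 <= rho' by lra.
(* The bound to be proved then keeps every iterate within [d] of [zs], where [step] applies. *)
exists (d / (CP + 1)) => [|z0 z0d T]; first by rewrite divr_gt0.
have bound h T' : N h <= rho' ^+ T' * N (z0 - zs) ->
    norm2 h <= CP * norm2 (z0 - zs) * rho' ^+ T'.
  move=> hN; apply: le_trans (le_N h) _.
  apply: le_trans (ler_wpM2l (copnorm2_ge0 _) hN) _.
  rewrite mulrCA [leRHS]mulrC ler_wpM2l ?exprn_ge0// /CP -mulrA mulrCA.
  by rewrite ler_wpM2l ?copnorm2_ge0.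
(* The induction runs in the norm [N], so the constant does not accumulate. *)
apply: (bound); elim: T => [|T IH]; first by rewrite expr0 mul1r.
have := bound _ _ IH; set h := iter T G z0 - zs => h_le.
rewrite iterS -[iter T G z0](subrK zs) [_ + zs]addrC -/h.
apply: le_trans (step _ _) _.
  apply: le_trans h_le _.
  have : CP * norm2 (z0 - zs) * rho' ^+ T <= CP * norm2 (z0 - zs).
    by rewrite ler_piMr ?exprn_ile1// (mulr_ge0 CP0 (norm2_ge0 _)).
  move: z0d; rewrite ler_pdivlMr// => z0d; have := norm2_ge0 (z0 - zs); lra.
by rewrite exprS -mulrA ler_wpM2l.
Qed.

(** From [1 - x <= exp (- x)], the power is at most [exp (- x T)], hence at most [eps / D]. The case
    [D = 0] is separate because of the logarithm. *)
Lemma geometric_le_of_log (x D eps : R) (T : nat) :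
  0 < x -> x <= 1 -> 0 <= D -> 0 < eps ->
  x^-1 * ln (D / eps) <= T%:R -> D * (1 - x) ^+ T <= eps.
Proof.
move=> x0 x1 D0 eps0 hT; have [->|Dneq0] := eqVneq D 0; first by rewrite mul0r ltW.
have D_gt0 : 0 < D by rewrite lt_neqAle eq_sym Dneq0.
have De : 0 < D / eps by rewrite divr_gt0.
rewrite -ler_pdivlMl//; apply: (@le_trans _ _ (expR (- (x * T%:R)))).
  rewrite -mulNr expRM_natr lerXn2r ?nnegrE ?subr_ge0 ?expR_ge0//.
  exact: expR_ge1Dx.
have -> : D^-1 * eps = expR (- ln (D / eps)).
  by rewrite expRN lnK ?posrE// invf_div mulrC.
by rewrite ler_expR lerN2 -ler_pdivrMl.
Qed.

End Linearization.

(** * Gradient descent-ascent and extragradient *)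

Section Game.
Context {R : realType} {n m : nat}.
Implicit Types (f : 'cV[R]_(n + m) -> R) (z : 'cV[R]_(n + m)).

Lemma grad_linearizes f z : differentiable (grad f) z -> linearizes (grad f) z (hess f z).
Proof.
move=> dg eps eps0; have [d d0 dP] := differentiable_norm2 dg eps0.
by exists d => // h hd; rewrite -diff_grad// dP.
Qed.

Definition step_mx (ex ey : R) : 'M[R]_(n + m) := block_mx (- ex%:M) 0 0 ey%:M.

Lemma gda_updateE f ex ey z w :
  gda_update f ex ey z w = z + step_mx ex ey *m grad f w.
Proof.
rewrite /gda_update -[in RHS](vsubmxK z) -[in RHS](vsubmxK (grad f w)).
by rewrite mul_block_col !mul0mx addr0 add0r mulNmx !mul_scalar_mx add_col_mx.
Qed.

(** Symmetry of the Hessian identifies its lower left block with [B^T]; the sign of the [x] stepsize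
    gives the first block row of [M]. *)
Lemma step_mx_hess f z r ex : (hess f z)^T = hess f z ->
  step_mx ex (r * ex) *m hess f z = ex *: Mmat f z r.
Proof.
move=> symH; rewrite /Mmat /hA /hB /hC trmx_ursub symH.
rewrite -[in LHS](submxK (hess f z)) mulmx_block !mul0mx !addr0 !add0r.
rewrite !mulNmx !mul_scalar_mx scale_block_mx.
by rewrite !scalerN !scalerA !opprK (mulrC ex r).
Qed.

Lemma gda_step_linearizes f z ex ey : differentiable (grad f) z ->
  linearizes (gda_step f ex ey) z (1%:M + step_mx ex ey *m hess f z).
Proof.
move=> dg; have -> : gda_step f ex ey = fun w => w + step_mx ex ey *m grad f w.
  by apply/funext => w; exact: gda_updateE.
apply: linearizesD; first exact: linearizes_id.
exact/linearizes_mulmx/grad_linearizes.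
Qed.

Lemma gda_step_fix f z ex ey : grad f z = 0 -> gda_step f ex ey z = z.
Proof. by move=> g0; rewrite /gda_step gda_updateE g0 mulmx0 addr0. Qed.

Lemma eg_step_fix f z ex ey : grad f z = 0 -> eg_step f ex ey z = z.
Proof.
move=> g0; rewrite /eg_step -/(gda_step f ex ey z) gda_step_fix//.
by rewrite gda_updateE g0 mulmx0 addr0.
Qed.

(** Chain rule through the half step, whose Jacobian is [1 + E]; it fixes [z], so the outer gradient
    is also expanded at [z]. *)
Lemma eg_step_linearizes f z ex ey : grad f z = 0 -> differentiable (grad f) z ->
  let E := step_mx ex ey *m hess f z in
  linearizes (eg_step f ex ey) z (1%:M + E *m (1%:M + E)).
Proof.
move=> g0 dg E.
have -> : eg_step f ex ey =
    fun w => w + step_mx ex ey *m (grad f \o gda_step f ex ey) w.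
  by apply/funext => w; exact: gda_updateE.
apply: linearizesD; first exact: linearizes_id.
rewrite /E -[X in linearizes _ _ X]mulmxA; apply: linearizes_mulmx.
apply: linearizes_comp; first exact: gda_step_linearizes.
by rewrite gda_step_fix//; exact: grad_linearizes.
Qed.

Lemma Mmat_mul f z r (u : 'cV[R]_n) (v : 'cV[R]_m) :
  Mmat f z r *m col_mx u v =
  col_mx (- (hC f z *m u) - hB f z *m v) (r *: ((hB f z)^T *m u) - r *: (hA f z *m v)).
Proof.
rewrite /Mmat; move: (hA f z) (hB f z) (hC f z) => A B C.
by rewrite mul_block_col !mulNmx -!scalemxAl.
Qed.

Lemma Mmat_eigenvalue_bounds f z (L mu mux r : R) (P Lam : 'M[R[i]]_(n + m)) j :
  (0 < n)%N -> (0 < m)%N -> (hess f z)^T = hess f z -> DSE f z ->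
  has_params f z L mu mux -> 2 * (L / mu) <= r ->
  P \in unitmx -> is_diag_mx Lam ->
  map_mx (real_complex R) (Mmat f z r) = invmx P *m Lam *m P ->
  [/\ 0 < mux, mux <= L, 2 <= r &
  let eta := 1 / (4 * r * L) in
  let p := - (eta * complex.Re (Lam j j)) in let b := eta * complex.Im (Lam j j) in
  [/\ mux / (r * L) / 8 <= p, p <= 1 / 4 & b ^+ 2 <= p / 2] ].
Proof.
move=> n0 m0 symH [_ [_ [posA posS]]] [opL [-> ->]] r_ge unitP diagL MP.
set A := hA f z in posA opL r_ge *; set mu' := lambda_min A.
rewrite !ge_max in opL; case/and3P: opL => A_le B_le C_le.
have [symA _] := posA.
have symC : (hC f z)^T = hC f z by rewrite /hC trmx_ulsub symH.
have unitA := posdef_unitmx posA.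
have mu_gt0 : 0 < mu' by exact: posdef_lambda_min.
have [_ A_ge] := lambda_minP m0 symA.
have [_ S_ge] := lambda_minP n0 posS.1.
(* An eigenvector for the least eigenvalue gives [mu <= L], hence [kappa >= 1] and [r >= 2]. *)
have muL : mu' <= L.
  have [/eigenvalueP[v vA v0] _] := lambda_minP m0 symA.
  have vT0 : v^T != 0 by rewrite trmx_eq0.
  have nv : 0 < norm2 v^T by rewrite lt_neqAle norm2_ge0 eq_sym norm2_eq0 vT0.
  rewrite -(ler_pM2r nv) -[mu']gtr0_norm// -norm2Z -linearZ /= -vA trmx_mul symA.
  by apply: le_trans (norm2_mulmx _ _) _; rewrite ler_wpM2r ?norm2_ge0.
have L_gt0 : 0 < L by lra.
have r_mu : 2 * L <= r * mu' by rewrite -ler_pdivrMr// -mulrA.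
have r_ge2 : 2 <= r by rewrite -(ler_pM2r mu_gt0); lra.
have r_gt0 : 0 < r by lra.
set mux' := Num.min _ _.
have mux_gt0 : 0 < mux' by rewrite lt_min L_gt0 posdef_lambda_min.
have mux_le : mux' <= L by rewrite ge_min lexx.
have {}S_ge w : mux' * dotv w w <= dotv w (schur f z *m w).
  by rewrite (le_trans _ (S_ge w))// ler_wpM2r ?dotv_ge0// ge_min lexx orbT.
split=> //; move=> eta.
have rL : 0 < r * L by rewrite mulr_gt0.
have eta_gt0 : 0 < eta by rewrite divr_gt0// -mulrA mulr_gt0.
have etaE : eta * (r * L) = 1 / 4.
  by rewrite /eta; field; rewrite !gt_eqF.
(* Non-real eigenvalues only give [- a >= L / 2 >= mux / 2]; this is where the 8 comes from. *)
have -> : mux' / (r * L) / 8 = eta * (mux' / 2).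
  by rewrite /eta; field; rewrite !gt_eqF.
clearbody eta.
have [x [y [xy0]]] := real_complex_eigenvector j unitP diagL MP.
set a := complex.Re _; set b := complex.Im _.
rewrite -(vsubmxK x) -(vsubmxK y) in xy0 *.
set u := usubmx x; set v := dsubmx x; set u' := usubmx y; set v' := dsubmx y.
rewrite !Mmat_mul !scale_col_mx opp_col_mx !add_col_mx.
move=> /eq_col_mx[e1 e3] /eq_col_mx[e2 e4].
rewrite !col_mx_eq0 !negb_and in xy0.
rewrite -!mulrN /=; have [b0|b0] := eqVneq b 0.
  (* For a real eigenvalue [x] and [y] satisfy the eigenvector equation separately, and one of them
     is nonzero. *)
  rewrite b0 !scale0r !(subr0, add0r) in e1 e2 e3 e4.
  have : - (r * L) <= a <= - mux'.
    case/orP: xy0 => w0.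
      exact: (real_eigenvalue_bounds symA unitA mu_gt0 mux_gt0 mux_le A_ge S_ge
        A_le C_le r_ge2 r_mu w0 e1 e3).
    exact: (real_eigenvalue_bounds symA unitA mu_gt0 mux_gt0 mux_le A_ge S_ge
        A_le C_le r_ge2 r_mu w0 e2 e4).
  move=> /andP[al au]; rewrite b0 mulr0 expr0n /=; split.
  - by rewrite ler_pM2l//; lra.
  - by rewrite -etaE ler_pM2l//; lra.
  - by rewrite divr_ge0// mulr_ge0 ?ltW//; lra.
have nz : (u != 0) || (u' != 0) || (v != 0) || (v' != 0).
  by move: xy0; do !case: (_ == 0).
have [a4 a2 bb] := complex_eigenvalue_bounds symA symC mu_gt0 L_gt0 A_ge A_le B_le C_le
  r_ge2 r_mu b0 nz e1 e2 e3 e4.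
split.
- by rewrite ler_pM2l//; lra.
- rewrite -etaE ler_pM2l//; have : 2 * L <= r * L by rewrite ler_pM2r.
  by lra.
(* Both sides are compared with [eta L / 4]: [eta b^2] is at most [L / 4], and [- a / 2] is at least
   [L / 4]. *)
- rewrite exprMn expr2 -!mulrA ler_pM2l//.
  have : eta * b ^+ 2 <= eta * (r * L ^+ 2) by rewrite ler_pM2l.
  have -> : eta * (r * L ^+ 2) = L / 4.
    have -> : eta * (r * L ^+ 2) = eta * (r * L) * L by ring.
    by rewrite etaE; lra.
  by lra.
Qed.

End Game.

(** * Local rates of GDA and EG and the resulting iteration count *)

Unset Implicit Arguments.
Set Strict Implicit.

Theorem theorem2 (R : realType) :
  exists c0 : R, 0 < c0 /\
  forall (n m : nat) (f : 'cV[R]_(n + m) -> R) (zs : 'cV[R]_(n + m))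
         (L mu mux r : R) (P Lam : 'M[R[i]]_(n + m)),
    (0 < n)%N -> (0 < m)%N ->
    C2 f -> DSE f zs -> has_params f zs L mu mux ->
    let kappa := L / mu in
    let kappax := L / mux in
    let etax := 1 / (4 * r * L) in
    let etay := 1 / (4 * L) in
    2 * kappa <= r ->
    P \in unitmx -> is_diag_mx Lam ->
    map_mx (real_complex R) (Mmat f zs r) = invmx P *m Lam *m P ->
    let CP := copnorm2 P * copnorm2 (invmx P) in
    exists delta : R, 0 < delta /\
      forall z0 : 'cV[R]_(n + m), norm2 (z0 - zs) <= delta ->
        (forall T : nat,
           norm2 (gda f etax etay z0 T - zs)
             <= CP * norm2 (z0 - zs) * (1 - c0 / (r * kappax)) ^+ T /\
           norm2 (eg f etax etay z0 T - zs)
             <= CP * norm2 (z0 - zs) * (1 - c0 / (r * kappax)) ^+ T) /\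
        (forall eps : R, 0 < eps ->
           forall T : nat,
             r * kappax / c0 * ln (CP * norm2 (z0 - zs) / eps) <= T%:R ->
             norm2 (gda f etax etay z0 T - zs) <= eps /\
             norm2 (eg f etax etay z0 T - zs) <= eps).
Proof.
(* The linearized steps contract by [1 - e / 32]; half of that gap is left to the nonlinear
   remainder. *)
exists (1 / 64); split; first by lra.
move=> n m f zs L mu mux r P Lam n0 m0 [df [dgrad _]] dse params kappa kappax etax etay.
move=> r_ge unitP diagL MP CP.
have dg := dgrad zs; have symH := hess_sym df dg.
have grad0 : grad f zs = 0.
  by rewrite -(vsubmxK (grad f zs)) dse.1 dse.2.1 col_mx0.
have bounds j := Mmat_eigenvalue_bounds j n0 m0 symH dse params r_ge unitP diagL MP.
(* These facts do not depend on the index; any one serves, and [n > 0] provides it. *)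
have [mux_gt0 mux_le r_ge2 _] := bounds (lshift m (Ordinal n0)).
have L_gt0 : 0 < L by lra.
have r_gt0 : 0 < r by lra.
have rL : 0 < r * L by rewrite mulr_gt0.
pose e := mux / (r * L).
have e_gt0 : 0 < e by rewrite divr_gt0.
have e_le1 : e <= 1.
  have : 2 * L <= r * L by rewrite ler_pM2r.
  by rewrite ler_pdivrMr// mul1r; lra.
have eE : 1 / 64 / (r * kappax) = e / 64.
  by rewrite /kappax /e; field; rewrite !gt_eqF.
have etayE : etay = r * etax by rewrite /etax /etay; field; rewrite !gt_eqF.
have EM : step_mx etax etay *m hess f zs = etax *: Mmat f zs r.
  by rewrite etayE step_mx_hess.
have rho0 : 0 <= 1 - e / 32 by lra.
have factors j : let p := - (etax * complex.Re (Lam j j)) in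
    let b := etax * complex.Im (Lam j j) in
    (1 - p) ^+ 2 + b ^+ 2 <= (1 - e / 32) ^+ 2 /\
    (1 - p + (p ^+ 2 - b ^+ 2)) ^+ 2 + (b - 2 * p * b) ^+ 2 <= (1 - e / 32) ^+ 2.
  have [_ _ _ [ep p4 bp]] := bounds j.
  by split; [apply: gda_factor_le|apply: eg_factor_le] => //; exact: ltW.
have contr := diag_step_le unitP diagL MP rho0 factors.
have lt_rho : 1 - e / 32 < 1 - e / 64 by lra.
have rho_le1 : 1 - e / 64 <= 1 by lra.
have [d1 d1_gt0 gda_rate] : exists2 delta : R, 0 < delta & forall z0,
    norm2 (z0 - zs) <= delta -> forall T,
    norm2 (gda f etax etay z0 T - zs) <= CP * norm2 (z0 - zs) * (1 - e / 64) ^+ T.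
  apply: (local_linear_rate _ (gda_step_linearizes etax etay dg)) rho0 _ _ => //.
    exact: gda_step_fix.
  by move=> h; rewrite EM mulmxDl mul1mx -scalemxAl; exact: (contr h).1.
have [d2 d2_gt0 eg_rate] : exists2 delta : R, 0 < delta & forall z0,
    norm2 (z0 - zs) <= delta -> forall T,
    norm2 (eg f etax etay z0 T - zs) <= CP * norm2 (z0 - zs) * (1 - e / 64) ^+ T.
  apply: (local_linear_rate _ (eg_step_linearizes etax etay grad0 dg)) rho0 _ _ => //.
    exact: eg_step_fix.
  move=> h; rewrite EM mulmxDl mul1mx -mulmxA mulmxDl mul1mx -!scalemxAl.
  exact: (contr h).2.
exists (Num.min d1 d2); split; first by rewrite lt_min d1_gt0.
move=> z0; rewrite le_min eE => /andP[z0d1 z0d2].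
split=> [T|eps eps0 T hT]; first by split; [exact: gda_rate|exact: eg_rate].
have D0 : 0 <= CP * norm2 (z0 - zs).
  by rewrite mulr_ge0 ?norm2_ge0// mulr_ge0 ?copnorm2_ge0.
have D_le : CP * norm2 (z0 - zs) * (1 - e / 64) ^+ T <= eps.
  apply: geometric_le_of_log => //; [lra|lra|].
  by rewrite -eE invf_div.
by split; [apply: le_trans (gda_rate _ _ _) _|apply: le_trans (eg_rate _ _ _) _].
Qed.
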